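(* Let $S$ be a Noetherian semidomain. Then the following statements are equivalent: (1) $S$ is a Dedekind semidomain; (2) $\mathfrak{a}(\mathfrak{b}\cap\mathfrak{c})=\mathfrak{a}\mathfrak{b}\cap\mathfrak{a}\mathfrak{c}$ for all ideals $\mathfrak{a},\mathfrak{b},\mathfrak{c}$ of $S$; (3) $(\mathfrak{a}+\mathfrak{b})(\mathfrak{a}\cap\mathfrak{b})=\mathfrak{a}\mathfrak{b}$ for all ideals $\mathfrak{a},\mathfrak{b}$ of $S$; (4) $[(\mathfrak{a}+\mathfrak{b}):\mathfrak{c}]=[\mathfrak{a}:\mathfrak{c}]+[\mathfrak{b}:\mathfrak{c}]$ for all ideals $\mathfrak{a},\mathfrak{b},\mathfrak{c}$ of $S$; (5) $[\mathfrak{a}:\mathfrak{b}]+[\mathfrak{b}:\mathfrak{a}]=S$ for all ideals $\mathfrak{a},\mathfrak{b}$ of $S$; (6) $[\mathfrak{c}:\mathfrak{a}\cap\mathfrak{b}]=[\mathfrak{c}:\mathfrak{a}]+[\mathfrak{c}:\mathfrak{b}]$ for all ideals $\mathfrak{a},\mathfrak{b},\mathfrak{c}$ of $S$.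
   Context: A semiring is $(S,+,\cdot,0,1)$ where $(S,+,0)$ and $(S,\cdot,1)$ are commutative monoids, $1\neq 0$, multiplication distributes over addition, and $a\cdot 0=0$ for all $a$. A semidomain is a semiring $S$ in which $ab=ac$ with $a\neq 0$ implies $b=c$. Its semifield of fractions $K=F(S)$ is the localization of $S$ at $S-\{0\}$. An ideal of $S$ is a nonempty subset closed under addition and under multiplication by elements of $S$. $S$ is Noetherian if each ideal of $S$ is finitely generated. The sum of ideals is $\mathfrak{a}+\mathfrak{b}=\{a+b: a\in\mathfrak{a}, b\in\mathfrak{b}\}$, the product $\mathfrak{a}\mathfrak{b}$ is the set of finite sums $\sum a_ib_i$ with $a_i\in\mathfrak{a}$, $b_i\in\mathfrak{b}$, and $[\mathfrak{a}:\mathfrak{b}]=\{s\in S: s\mathfrak{b}\subseteq\mathfrak{a}\}$. A fractional ideal of $S$ is a nonempty subset $A\subseteq K$ closed under addition and under multiplication by elements of $S$ such that $dA\subseteq S$ for some nonzero $d\in S$. With the product $AB$ of fractional ideals $A$ and $B$ defined as the set of finite sums $\sum a_ib_i$ with $a_i\in A$, $b_i\in B$, $A$ is invertible if $AB=S$ for some fractional ideal $B$. A Dedekind semidomain is a semidomain in which each nonzero fractional ideal is invertible. *)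

(* Defs.v *)
From HB Require Import structures.
From mathcomp Require Import all_boot all_algebra.
From mathcomp Require Import generic_quotient ring.
From mathcomp Require Import boolp classical_sets cardinality.

Set Implicit Arguments.
Unset Strict Implicit.
Unset Printing Implicit Defensive.

Import GRing.Theory.

Local Open Scope classical_set_scope.
Local Open Scope ring_scope.

(* A semiring (commutative, with 1 != 0) is a comNzSemiRingType. *)
HB.mixin Record isSemidomain S & GRing.ComNzSemiRing S := {
  sd_mulfI : forall a b c : S, a != 0 -> a * b = a * c -> b = c
}.

#[short(type="semidomainType")]
HB.structure Definition Semidomain :=
  {S of isSemidomain S & GRing.ComNzSemiRing S}.

Lemma sd_mulf_neq0 (S : semidomainType) (a b : S) :
  a != 0 -> b != 0 -> a * b != 0.
Proof.
move=> a0; apply: contra_neq => ab0.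
by apply: (sd_mulfI _ _ _ a0); rewrite ab0 mulr0.
Qed.

(* The localization of S at S - {0}: pairs (a, s) with s != 0, where (a, s) and
   (b, t) are identified when a * t = b * s. The usual extra factor u in
   u * a * t = u * b * s is superfluous by cancellation. MathComp's
   {fraction _} is not available here, as it requires a ring. *)
Module SemiFrac.
Section SemiFrac.
Local Open Scope quotient_scope.

Variable S : semidomainType.

Definition ratio := {x : S * S | x.2 != 0}.
HB.instance Definition _ := Choice.on ratio.

Definition mkratio (a s : S) (s0 : s != 0) : ratio :=
  exist (fun x : S * S => x.2 != 0) (a, s) s0.

Local Notation num x := (val x).1.
Local Notation den x := (val x).2.

Implicit Types x y z : ratio.

Definition equivf x y := num x * den y == num y * den x.

Lemma equivf_refl : reflexive equivf.
Proof. by move=> x; rewrite /equivf. Qed.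

Lemma equivf_sym : symmetric equivf.
Proof. by move=> x y; rewrite /equivf eq_sym. Qed.

Lemma equivf_trans : transitive equivf.
Proof.
move=> [[b t] /= t0] [[a s] /= s0] [[c u] /= u0]; rewrite /equivf /=.
move=> /eqP ab /eqP bc; apply/eqP; apply: (sd_mulfI _ _ _ t0).
transitivity (a * t * u); first by ring.
rewrite ab; transitivity (b * u * s); first by ring.
by rewrite bc; ring.
Qed.

Canonical equivf_equiv := EquivRel equivf equivf_refl equivf_sym equivf_trans.

Definition type := {eq_quot equivf}.
HB.instance Definition _ : EqQuotient _ equivf type := EqQuotient.on type.
HB.instance Definition _ := Choice.on type.

Lemma equivf_repr x :
  num (repr (\pi_type x)) * den x = num x * den (repr (\pi_type x)).
Proof.
have /eqP := reprK (\pi_type x).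
by rewrite eqmodE => /eqP.
Qed.

Definition embed := lift_embed type (fun a : S => mkratio a (oner_neq0 S)).
Canonical embed_pi_morph := PiEmbed embed.

Definition addf x y :=
  mkratio (num x * den y + num y * den x) (sd_mulf_neq0 (valP x) (valP y)).
Definition add := lift_op2 type addf.

Lemma pi_add : {morph \pi : x y / addf x y >-> add x y}.
Proof.
move=> x y; unlock add; apply/eqmodP; rewrite /= /equivf /addf /=; apply/eqP.
have := equivf_repr x; have := equivf_repr y.
move: (repr _) (repr _) => [[a' s'] /= _] [[b' t'] /= _].
case: x y => [[a s] /= _] [[b t] /= _] eb ea.
transitivity (a * s' * t * t' + b * t' * s * s'); first by ring.
by rewrite -ea -eb; ring.
Qed.
Canonical pi_add_morph := PiMorph2 pi_add.

Definition mulf x y :=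
  mkratio (num x * num y) (sd_mulf_neq0 (valP x) (valP y)).
Definition mul := lift_op2 type mulf.

Lemma pi_mul : {morph \pi : x y / mulf x y >-> mul x y}.
Proof.
move=> x y; unlock mul; apply/eqmodP; rewrite /= /equivf /mulf /=; apply/eqP.
have := equivf_repr x; have := equivf_repr y.
move: (repr _) (repr _) => [[a' s'] /= _] [[b' t'] /= _].
case: x y => [[a s] /= _] [[b t] /= _] eb ea.
transitivity ((a * s') * (b * t')); first by ring.
by rewrite -ea -eb; ring.
Qed.
Canonical pi_mul_morph := PiMorph2 pi_mul.

Lemma addA : associative add.
Proof.
elim/quotW=> x; elim/quotW=> y; elim/quotW=> z; apply/eqP.
by rewrite !piE /equivf /addf /=; apply/eqP; ring.
Qed.

Lemma addC : commutative add.
Proof.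
elim/quotW=> x; elim/quotW=> y; apply/eqP.
by rewrite !piE /equivf /addf /=; apply/eqP; ring.
Qed.

Lemma add0 : left_id (embed 0) add.
Proof.
elim/quotW=> x; apply/eqP.
by rewrite !piE /equivf /addf /=; apply/eqP; ring.
Qed.

Lemma mulA : associative mul.
Proof.
elim/quotW=> x; elim/quotW=> y; elim/quotW=> z; apply/eqP.
by rewrite !piE /equivf /mulf /=; apply/eqP; ring.
Qed.

Lemma mulC : commutative mul.
Proof.
elim/quotW=> x; elim/quotW=> y; apply/eqP.
by rewrite !piE /equivf /mulf /=; apply/eqP; ring.
Qed.

Lemma mul1 : left_id (embed 1) mul.
Proof.
elim/quotW=> x; apply/eqP.
by rewrite !piE /equivf /mulf /=; apply/eqP; ring.
Qed.

Lemma mulD : left_distributive mul add.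
Proof.
elim/quotW=> x; elim/quotW=> y; elim/quotW=> z; apply/eqP.
by rewrite !piE /equivf /mulf /addf /=; apply/eqP; ring.
Qed.

Lemma mul0 : left_zero (embed 0) mul.
Proof.
elim/quotW=> x; apply/eqP.
by rewrite !piE /equivf /mulf /=; apply/eqP; ring.
Qed.

Lemma one_neq0 : embed 1 != embed 0.
Proof. by rewrite piE /equivf /= !mulr1 oner_neq0. Qed.

HB.instance Definition _ := GRing.isNmodule.Build type addA addC add0.
HB.instance Definition _ :=
  GRing.Nmodule_isComNzSemiRing.Build type mulA mulC mul1 mulD mul0 one_neq0.

End SemiFrac.
End SemiFrac.

HB.export SemiFrac.

Definition semifrac (S : semidomainType) : Type := SemiFrac.type S.
HB.instance Definition _ (S : semidomainType) :=
  GRing.ComNzSemiRing.on (semifrac S).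

Definition to_semifrac (S : semidomainType) (a : S) : semifrac S :=
  SemiFrac.embed a.

Section SemiFracTheory.
Variable S : semidomainType.
Local Notation "a %:K" := (to_semifrac a) (at level 2, format "a %:K").

Lemma to_semifrac_inj : injective (@to_semifrac S).
Proof.
move=> a b /eqP; rewrite /to_semifrac !piE /SemiFrac.equivf /= !mulr1.
by move/eqP.
Qed.

Lemma to_semifracD (a b : S) : (a + b)%:K = a%:K + b%:K.
Proof.
apply/eqP; rewrite /to_semifrac [X in _ == X]piE !piE.
by rewrite /SemiFrac.equivf /=; apply/eqP; ring.
Qed.

Lemma to_semifracM (a b : S) : (a * b)%:K = a%:K * b%:K.
Proof.
apply/eqP; rewrite /to_semifrac [X in _ == X]piE !piE.
by rewrite /SemiFrac.equivf /=; apply/eqP; ring.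
Qed.

Lemma semifrac_surj (x : semifrac S) :
  exists a s : S, s != 0 /\ s%:K * x = a%:K.
Proof.
elim/quotW: x => -[[a s] /= s0]; exists a, s; split => //.
apply/eqP; rewrite /to_semifrac !piE.
by rewrite /SemiFrac.equivf /=; apply/eqP; ring.
Qed.

Lemma semifrac_inv (x : semifrac S) : x != 0 -> exists y, x * y = 1.
Proof.
elim/quotW: x => -[[a s] /= s0]; rewrite !piE /SemiFrac.equivf /= mulr1 mul0r.
move=> a0; exists (\pi_(SemiFrac.type S) (SemiFrac.mkratio s a0))%qT.
by apply/eqP; rewrite !piE /SemiFrac.equivf /=; apply/eqP; ring.
Qed.

End SemiFracTheory.

Section Subsets.
Variable R : comNzSemiRingType.
Implicit Types A B : set R.

Definition addset A B : set R := [set a + b | a in A & b in B].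

Definition mulset A B : set R :=
  [set x | exists n (a b : 'I_n -> R),
     [/\ forall i, A (a i), forall i, B (b i) & x = \sum_(i < n) a i * b i]].

End Subsets.

Section Ideals.
Variable S : comNzSemiRingType.
Implicit Types a b c : set S.

Definition is_ideal a :=
  [/\ a !=set0,
      forall x y, a x -> a y -> a (x + y)
    & forall s x, a x -> a (s * x)].

(* smallest is_ideal G is the ideal generated by G *)
Definition fin_gen_ideal a :=
  exists2 G : set S, finite_set G & a = smallest is_ideal G.

Definition residual a b : set S := [set s | forall x, b x -> a (s * x)].

End Ideals.

Definition noetherian (S : comNzSemiRingType) :=
  forall a : set S, is_ideal a -> fin_gen_ideal a.

Section FractionalIdeals.
Variable S : semidomainType.
Implicit Types A B : set (semifrac S).

Definition is_fractional_ideal A :=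
  [/\ A !=set0,
      forall x y, A x -> A y -> A (x + y),
      forall (s : S) x, A x -> A (to_semifrac s * x)
    & exists2 d : S, d != 0 &
        forall x, A x -> range (@to_semifrac S) (to_semifrac d * x)].

Definition invertible A :=
  exists2 B, is_fractional_ideal B & mulset A B = range (@to_semifrac S).

End FractionalIdeals.

Definition dedekind (S : semidomainType) :=
  forall A : set (semifrac S),
    is_fractional_ideal A -> A <> [set 0] -> invertible A.

Declare Scope ideal_scope.
Delimit Scope ideal_scope with ideal.
Notation "a + b" := (addset a b) : ideal_scope.
Notation "a * b" := (mulset a b) : ideal_scope.
Notation "[ a : b ]" := (residual a b)
  (at level 0, a at level 99, b at level 99, format "[ a  :  b ]")
  : ideal_scope.

(* Main.v *)
Require Import Defs.
From mathcomp Require Import all_boot all_algebra.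
From mathcomp Require Import ring.
From mathcomp Require Import boolp classical_sets cardinality.

(**
  Condition (5) is the pivot: splitting [1 = u + v] with [u * b] inside [a] and
  [v * a] inside [b] distributes residuals, giving (4) and (6), which in turn
  give (5) for [c = a + b] and for [c = a `&` b].  If [J] is the inverse of
  [a + b], then [1] lies in [J * a + J * b], and such a splitting is read off;
  so (1) implies (5).  Also (1) implies (2) since [a] can be cancelled, and (2)
  implies (3) since [(a + b) * (a `&` b)] becomes [(a + b) * a `&` (a + b) * b].

  Back to (1): nonzero principal ideals are invertible, so in the Noetherian
  case it suffices that the sum of two invertible ideals is invertible.  Under
  (3) the factor [a + b] of the invertible ideal [a * b] is invertible; under
  (5) the inverse of [a + b] is built from [u * a^-1] and [v * b^-1].
*)

Import GRing.Theory.

Local Open Scope classical_set_scope.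
Local Open Scope ring_scope.
Local Open Scope ideal_scope.

Section IdealArithmetic.
Variable R : comNzSemiRingType.
Implicit Types (A B C a b c : set R) (x y : R).

Lemma addsetP A B x y : A x -> B y -> (A + B)%ideal (x + y)%R.
Proof. by move=> Ax By; exists x => //; exists y. Qed.

Lemma mulset0 A B : (A * B)%ideal 0%R.
Proof.
exists 0%N, (fun=> 0%R), (fun=> 0%R); split; [by case..|].
by rewrite big_ord0.
Qed.

Lemma mulsetP A B x y : A x -> B y -> (A * B)%ideal (x * y)%R.
Proof.
move=> Ax By; exists 1%N, (fun=> x), (fun=> y); split=> //.
by rewrite big_ord1.
Qed.

Lemma mulsetD A B x y :
  (A * B)%ideal x -> (A * B)%ideal y -> (A * B)%ideal (x + y)%R.
Proof.
move=> [m [a1 [b1 [Aa1 Bb1 ->]]]] [n [a2 [b2 [Aa2 Bb2 ->]]]].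
pose glue (f : 'I_m -> R) (g : 'I_n -> R) (i : 'I_(m + n)) :=
  match split i with inl j => f j | inr k => g k end.
exists (m + n)%N, (glue a1 a2), (glue b1 b2); split.
- by move=> i; rewrite /glue; case: (split i).
- by move=> i; rewrite /glue; case: (split i).
rewrite big_split_ord /=; congr +%R; apply: eq_bigr => i _; rewrite /glue.
  by rewrite (unsplitK (inl i)).
by rewrite (unsplitK (inr i)).
Qed.

Lemma mulset_sub A B C : C 0%R -> (forall x y, C x -> C y -> C (x + y)%R) ->
  (forall x y, A x -> B y -> C (x * y)%R) -> A * B `<=` C.
Proof.
move=> C0 CD CM _ [n [f [g [Af Bg ->]]]].
by apply: (big_ind C) => // i _; apply: CM.
Qed.

Lemma ideal0 a : is_ideal a -> a 0%R.
Proof. by case=> -[x ax] _ aM; rewrite -(mul0r x); apply: aM. Qed.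

Lemma idealD a x y : is_ideal a -> a x -> a y -> a (x + y)%R.
Proof. by case=> _ aD _; apply: aD. Qed.

Lemma idealMl a x y : is_ideal a -> a y -> a (x * y)%R.
Proof. by case=> _ _ aM; apply: aM. Qed.

Lemma is_ideal_add a b : is_ideal a -> is_ideal b -> is_ideal (a + b).
Proof.
move=> ida idb; split.
- by exists (0 + 0)%R; apply: addsetP; apply: ideal0.
- move=> _ _ [x1 ax1 [y1 by1 <-]] [x2 ax2 [y2 by2 <-]].
  by rewrite addrACA; apply: addsetP; apply: idealD.
- move=> s _ [x ax [y b_y <-]].
  by rewrite mulrDr; apply: addsetP; apply: idealMl.
Qed.

Lemma is_ideal_capI a b : is_ideal a -> is_ideal b -> is_ideal (a `&` b).
Proof.
move=> ida idb; split.
- by exists 0%R; split; apply: ideal0.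
- by move=> x y [ax bx] [ay b_y]; split; apply: idealD.
- by move=> s x [ax bx]; split; apply: idealMl.
Qed.

Lemma sub_addl a b : is_ideal b -> a `<=` a + b.
Proof. by move=> idb x ax; rewrite -[x]addr0; apply: addsetP (ideal0 _ idb). Qed.

Lemma sub_addr a b : is_ideal a -> b `<=` a + b.
Proof. by move=> ida x bx; rewrite -[x]add0r; apply: addsetP (ideal0 _ ida) bx. Qed.

Lemma is_ideal_smallest A : is_ideal (smallest (@is_ideal _) A).
Proof.
split.
- by exists 0%R => I [idI _]; apply: ideal0.
- by move=> x y Ax Ay I AI; apply: (idealD _ _ _ AI.1); [apply: Ax|apply: Ay].
- by move=> s x Ax I AI; apply: (idealMl _ _ _ AI.1); apply: Ax.
Qed.

Definition principal x : set R := range (fun s => s * x)%R.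

Lemma is_ideal_principal x : is_ideal (principal x).
Proof.
split.
- by exists (1 * x)%R; exists 1%R.
- by move=> _ _ [s _ <-] [t _ <-]; exists (s + t)%R; rewrite ?mulrDl.
- by move=> s _ [t _ <-]; exists (s * t)%R; rewrite ?mulrA.
Qed.

Lemma smallest_ideal_nil : smallest (@is_ideal _) [set` @nil R] `<=` [set 0%R].
Proof.
apply: smallest_sub => //; split.
- by exists 0%R.
- by move=> _ _ -> ->; rewrite addr0.
- by move=> s _ ->; rewrite mulr0.
Qed.

Lemma smallest_ideal_cons x (s : seq R) :
  smallest (@is_ideal _) [set` x :: s] =
  principal x + smallest (@is_ideal _) [set` s].
Proof.
have idx := is_ideal_principal x; have ids := is_ideal_smallest [set` s].
apply/seteqP; split.
  apply: smallest_sub; first exact: is_ideal_add.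
  move=> y; rewrite /= inE => /orP[/eqP->|sy].
    by apply: sub_addl => //; exists 1%R; rewrite ?mul1r.
  by apply: sub_addr => //; apply: sub_gen_smallest.
move=> _ [_ [r _ <-] [z sz <-]] I [idI sI]; apply: (idealD _ _ _ idI).
  by apply: idealMl => //; apply: sI; rewrite /= mem_head.
by apply: sz; split=> // y /= sy; apply: sI; rewrite /= inE sy orbT.
Qed.

End IdealArithmetic.

Section Residuals.
Variable S : comNzSemiRingType.
Implicit Types (a b c : set S).

Definition comaximal_residuals := forall a b : set S,
  is_ideal a -> is_ideal b -> [a : b] + [b : a] = [set: S].

Lemma comaximal_residualsP :
  (forall a b : set S, is_ideal a -> is_ideal b ->
     exists u v : S, [/\ [a : b] u, [b : a] v & (u + v)%R = 1%R]) ->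
  comaximal_residuals.
Proof.
move=> split1 a b ida idb; apply/seteqP; split=> // s _.
have [u [v [ub va uv]]] := split1 a b ida idb.
rewrite -[s]mulr1 -uv mulrDr; apply: addsetP => x ?.
  by rewrite -mulrA; apply: idealMl => //; apply: ub.
by rewrite -mulrA; apply: idealMl => //; apply: va.
Qed.

Lemma comaximal_residuals_split : comaximal_residuals ->
  forall a b : set S, is_ideal a -> is_ideal b ->
    exists u v : S, [/\ [a : b] u, [b : a] v & (u + v)%R = 1%R].
Proof.
move=> com a b ida idb.
have /(_ 1%R I)[u ub [v va uv]] : [set: S] `<=` [a : b] + [b : a] by rewrite com.
by exists u, v.
Qed.

Lemma residual_add_sub a b c : is_ideal a -> is_ideal b ->
  [a : c] + [b : c] `<=` [(a + b) : c].
Proof.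
move=> ida idb _ [x xc [y yc <-]] z cz.
by rewrite mulrDl; apply: addsetP; [apply: xc|apply: yc].
Qed.

Lemma residual_cap_sub a b c : is_ideal c ->
  [c : a] + [c : b] `<=` [c : a `&` b].
Proof.
move=> idc _ [x xa [y yb <-]] z [az bz].
by rewrite mulrDl; apply: idealD => //; [apply: xa|apply: yb].
Qed.

Lemma comaximal_residual_add : comaximal_residuals ->
  forall a b c : set S, is_ideal a -> is_ideal b -> is_ideal c ->
    [(a + b) : c] = [a : c] + [b : c].
Proof.
move=> com a b c ida idb idc; apply/seteqP; split; last exact: residual_add_sub.
move=> x xc;
have [u [v [ub va uv]]] := comaximal_residuals_split com a b ida idb.
rewrite -[x]mul1r -uv mulrDl; apply: addsetP => z cz; rewrite -mulrA.
- have [p ap [q bq <-]] := xc z cz; rewrite mulrDr.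
  by apply: idealD => //; [apply: idealMl|apply: ub].
- have [p ap [q bq <-]] := xc z cz; rewrite mulrDr.
  by apply: idealD => //; [apply: va|apply: idealMl].
Qed.

Lemma residual_add_comaximal :
  (forall a b c : set S, is_ideal a -> is_ideal b -> is_ideal c ->
     [(a + b) : c] = [a : c] + [b : c]) -> comaximal_residuals.
Proof.
move=> resD; apply: comaximal_residualsP => a b ida idb.
have : [(a + b) : (a + b)] 1%R by move=> x; rewrite mul1r.
rewrite resD //; last exact: is_ideal_add.
move=> [u uab [v vab uv]]; exists u, v; split=> // x ?.
  by apply: uab; apply: sub_addr.
by apply: vab; apply: sub_addl.
Qed.

Lemma comaximal_residual_cap : comaximal_residuals ->
  forall a b c : set S, is_ideal a -> is_ideal b -> is_ideal c ->
    [c : a `&` b] = [c : a] + [c : b].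
Proof.
move=> com a b c ida idb idc; apply/seteqP; split; last exact: residual_cap_sub.
move=> x xab;
have [u [v [ub va uv]]] := comaximal_residuals_split com a b ida idb.
rewrite -[x]mulr1 -uv addrC mulrDr; apply: addsetP => z ?; rewrite -mulrA.
- by apply: xab; split; [apply: idealMl|apply: va].
- by apply: xab; split; [apply: ub|apply: idealMl].
Qed.

Lemma residual_cap_comaximal :
  (forall a b c : set S, is_ideal a -> is_ideal b -> is_ideal c ->
     [c : a `&` b] = [c : a] + [c : b]) -> comaximal_residuals.
Proof.
move=> resI; apply: comaximal_residualsP => a b ida idb.
have : [a `&` b : a `&` b] 1%R by move=> x; rewrite mul1r.
rewrite resI //; last exact: is_ideal_capI.
move=> [v va [u ub uv]]; exists u, v; split; last by rewrite addrC.
  by move=> x /ub[].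
by move=> x /va[].
Qed.

Lemma add_mul_cap :
  (forall a b c : set S, is_ideal a -> is_ideal b -> is_ideal c ->
     a * (b `&` c) = (a * b) `&` (a * c)) ->
  forall a b : set S, is_ideal a -> is_ideal b -> (a + b) * (a `&` b) = a * b.
Proof.
move=> mulI a b ida idb; apply/seteqP; split.
  apply: mulset_sub; [exact: mulset0|exact: mulsetD|].
  move=> _ z [x ax [y b_y <-]] [az bz]; rewrite mulrDl; apply: mulsetD.
    exact: mulsetP.
  by rewrite mulrC; apply: mulsetP.
rewrite mulI //; last exact: is_ideal_add.
apply: mulset_sub => [|x y|x y ax b_y].
- by split; apply: mulset0.
- by move=> [? ?] [? ?]; split; apply: mulsetD.
split; last by apply: mulsetP => //; apply: sub_addl.
by rewrite mulrC; apply: mulsetP => //; apply: sub_addr.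
Qed.

End Residuals.

Section Invertibility.
Variable S : semidomainType.
Local Notation K := (semifrac S).
Local Notation "x %:K" := (@to_semifrac S x) (at level 2, format "x %:K").
Implicit Types (A B : set K) (a b c : set S).

Lemma to_semifrac0 : 0%:K = 0%R :> K. Proof. by []. Qed.

Lemma to_semifrac1 : 1%:K = 1%R :> K. Proof. by []. Qed.

Lemma to_semifrac_eq0 (s : S) : s%:K = 0%R -> s = 0%R.
Proof. by rewrite -to_semifrac0 => /to_semifrac_inj. Qed.

Definition inverse A : set K :=
  [set y | forall x, A x -> range (@to_semifrac S) (x * y)%R].

Definition has_inverse A := (A * inverse A)%ideal 1%R.

Lemma invertible_has_inverse A : invertible A -> has_inverse A.
Proof.
move=> [B fB AB]; have : (A * B)%ideal 1%R by rewrite AB; exists 1%R.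
apply: mulset_sub; [exact: mulset0|exact: mulsetD|].
move=> x y Ax By; apply: mulsetP => // z Az.
by rewrite -AB; apply: mulsetP.
Qed.

Lemma range_to_semifracD (x y : K) : range (@to_semifrac S) x ->
  range (@to_semifrac S) y -> range (@to_semifrac S) (x + y)%R.
Proof. by move=> [s _ <-] [t _ <-]; exists (s + t)%R; rewrite ?to_semifracD. Qed.

Lemma range_to_semifracM (x y : K) : range (@to_semifrac S) x ->
  range (@to_semifrac S) y -> range (@to_semifrac S) (x * y)%R.
Proof. by move=> [s _ <-] [t _ <-]; exists (s * t)%R; rewrite ?to_semifracM. Qed.

Lemma fractional_ideal_inverse A : is_fractional_ideal A -> A <> [set 0%R] ->
  is_fractional_ideal (inverse A).
Proof.
move=> [[x0 Ax0] AD AM [d d0 dA]] An0.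
have [x Ax xn0] : exists2 x, A x & x != 0%R.
  apply: contra_notP An0 => noA; apply/seteqP.
  have A0 x : A x -> x = 0%R.
    by move=> Ax; apply: contra_notP noA => /eqP xn0; exists x.
  by split=> [x /A0 //|_ ->]; rewrite -(A0 _ Ax0).
split.
- by exists 0%R => y Ay; rewrite mulr0; exists 0%R.
- move=> y z Iy Iz w Aw; rewrite mulrDr.
  by apply: range_to_semifracD; [apply: Iy|apply: Iz].
- move=> s y Iy w Aw; rewrite mulrCA.
  by apply: range_to_semifracM; [exists s|apply: Iy].
have [n [s [sn0 sx]]] := semifrac_surj x.
exists n; last by move=> y Iy; rewrite -sx; apply: Iy; apply: AM.
apply: contra_neq xn0 => n0; move: sx; rewrite n0 to_semifrac0 => sx.
have [t st] : exists t, (s%:K * t)%R = 1%R.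
  by apply: semifrac_inv; apply: contra_neq sn0; apply: to_semifrac_eq0.
by rewrite -[x]mul1r -st mulrAC sx mul0r.
Qed.

Lemma has_inverse_invertible A : is_fractional_ideal A -> A <> [set 0%R] ->
  has_inverse A -> invertible A.
Proof.
move=> fA An0 A1; exists (inverse A); first exact: fractional_ideal_inverse.
apply/seteqP; split.
  apply: mulset_sub; [by exists 0%R|exact: range_to_semifracD|].
  by move=> x y Ax; apply.
move=> _ [s _ <-]; rewrite -[_%:K]mulr1.
have [_ _ AM _] := fA.
apply: (@mulset_sub _ _ _ [set y | (A * inverse A)%ideal (s%:K * y)%R]) A1.
- by rewrite /= mulr0; apply: mulset0.
- by move=> x y /= ? ?; rewrite mulrDr; apply: mulsetD.
- by move=> x y Ax Iy /=; rewrite mulrA; apply: mulsetP => //; apply: AM.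
Qed.

Definition invertible_ideal a := has_inverse (@to_semifrac S @` a).

Lemma dedekind_invertible_ideal : dedekind S ->
  forall a, is_ideal a -> a `<=` [set 0%R] \/ invertible_ideal a.
Proof.
move=> dedS a ida; have [a0|an0] := pselect (a `<=` [set 0%R]); [by left|right].
apply: invertible_has_inverse; apply: dedS.
  split.
  - by case: ida => -[x ax] _ _; exists x%:K; exists x.
  - move=> _ _ [x ax <-] [y ay <-]; exists (x + y)%R; first exact: idealD.
    by rewrite to_semifracD.
  - move=> s _ [x ax <-]; exists (s * x)%R; first exact: idealMl.
    by rewrite to_semifracM.
  - exists 1%R; first exact: oner_neq0.
    by move=> _ [x ax <-]; exists x; rewrite // to_semifrac1 mul1r.
move=> aE; apply: an0 => x ax; apply: to_semifrac_eq0.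
have : (@to_semifrac S @` a) x%:K by exists x.
by rewrite aE.
Qed.

Lemma dedekind_mul_cap : dedekind S ->
  forall a b c, is_ideal a -> is_ideal b -> is_ideal c ->
    a * (b `&` c) = (a * b) `&` (a * c).
Proof.
move=> dedS a b c ida idb idc; apply/seteqP; split.
  apply: mulset_sub => [|x y|x y ax [b_y cy]].
  - by split; apply: mulset0.
  - by move=> [? ?] [? ?]; split; apply: mulsetD.
  by split; apply: mulsetP.
have [a0|a1] := dedekind_invertible_ideal dedS a ida.
  move=> x [xab _]; suff -> : x = 0%R by apply: mulset0.
  apply: (@mulset_sub _ a b [set 0%R]) xab => // [_ _ -> ->|y z /a0 -> _].
    by rewrite addr0.
  by rewrite mul0r.
have cancel_a e x p : is_ideal e -> (a * e)%ideal x ->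
    inverse (@to_semifrac S @` a) p -> exists2 y, e y & (p * x%:K)%R = y%:K.
  move=> ide xae Ip.
  apply: (@mulset_sub _ a e
    [set x | exists2 y, e y & (p * x%:K)%R = y%:K]) xae.
  - by exists 0%R; [exact: ideal0|rewrite mulr0].
  - move=> u v [y ey py] [z ez pz]; exists (y + z)%R; first exact: idealD.
    by rewrite !to_semifracD mulrDr py pz.
  - move=> u v au ev; have [s _ su] : range (@to_semifrac S) (u%:K * p)%R.
      by apply: Ip; exists u.
    exists (s * v)%R; first exact: idealMl.
    by rewrite !to_semifracM su mulrCA mulrA.
move=> x [xab xac].
suff [y yabc /to_semifrac_inj <-//] :
    exists2 y, (a * (b `&` c))%ideal y & y%:K = x%:K.
rewrite -[x%:K]mul1r.
apply: (@mulset_sub _ _ _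
  [set z | exists2 y, (a * (b `&` c))%ideal y & y%:K = (z * x%:K)%R]) a1.
- by exists 0%R; [exact: mulset0|rewrite mul0r].
- move=> u v [y ? yu] [z ? zv]; exists (y + z)%R; first exact: mulsetD.
  by rewrite to_semifracD mulrDl yu zv.
move=> _ p [u au <-] Ip.
have [y b_y py] := cancel_a b x p idb xab Ip.
have [z cz pz] := cancel_a c x p idc xac Ip.
have yz : y = z by apply: to_semifrac_inj; rewrite -py.
exists (u * y)%R; first by apply: mulsetP => //; split; rewrite // yz.
by rewrite to_semifracM -mulrA py.
Qed.

Lemma dedekind_comaximal : dedekind S -> comaximal_residuals S.
Proof.
move=> dedS; apply: comaximal_residualsP => a b ida idb.
have idab := is_ideal_add _ _ _ ida idb.
have [ab0|] := dedekind_invertible_ideal dedS _ idab.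
  exists 1%R, 0%R; split; last by rewrite addr0.
    move=> x bx; have /ab0 -> : (a + b)%ideal x by apply: sub_addr.
    by rewrite mulr0; apply: ideal0.
  by move=> x _; rewrite mul0r; apply: ideal0.
move=> ab1; suff [u [v [ub va uv]]] :
    exists u v, [/\ [a : b] u, [b : a] v & u%:K + v%:K = 1 :> K]%R.
  by exists u, v; split=> //; apply: to_semifrac_inj; rewrite to_semifracD.
apply: (@mulset_sub _ _ _
  [set z | exists u v, [/\ [a : b] u, [b : a] v & u%:K + v%:K = z :> K]%R]) ab1.
- exists 0%R, 0%R; split; last by rewrite to_semifrac0 addr0.
    by move=> x _; rewrite mul0r; apply: ideal0.
  by move=> x _; rewrite mul0r; apply: ideal0.
- move=> _ _ [u1 [v1 [ub1 va1 <-]]] [u2 [v2 [ub2 va2 <-]]].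
  exists (u1 + u2)%R, (v1 + v2)%R; split; last by rewrite !to_semifracD addrACA.
    by move=> x bx; rewrite mulrDl; apply: idealD => //; [apply: ub1|apply: ub2].
  by move=> x ax; rewrite mulrDl; apply: idealD => //; [apply: va1|apply: va2].
move=> _ p [_ [x ax [y b_y <-]] <-] Ip.
have Ka z : a z -> range (@to_semifrac S) (z%:K * p)%R.
  by move=> az; apply: Ip; exists z => //; apply: sub_addl.
have Kb z : b z -> range (@to_semifrac S) (z%:K * p)%R.
  by move=> bz; apply: Ip; exists z => //; apply: sub_addr.
have [[s _ sx] [t _ ty]] := (Ka x ax, Kb y b_y).
exists s, t; split; last by rewrite to_semifracD mulrDl sx ty.
- move=> z bz; have [r _ rz] := Kb z bz.
  suff -> : (s * z = r * x)%R by apply: idealMl.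
  by apply: to_semifrac_inj; rewrite !to_semifracM sx rz; ring.
- move=> z az; have [r _ rz] := Ka z az.
  suff -> : (t * z = r * y)%R by apply: idealMl.
  by apply: to_semifrac_inj; rewrite !to_semifracM ty rz; ring.
Qed.

Lemma invertible_principal (x : S) : x != 0%R -> invertible_ideal (principal _ x).
Proof.
move=> x0; have [y xy] : exists y, (x%:K * y)%R = 1%R.
  by apply: semifrac_inv; apply: contra_neq x0; apply: to_semifrac_eq0.
rewrite /invertible_ideal /has_inverse -xy; apply: mulsetP.
  by exists x => //; exists 1%R; rewrite ?mul1r.
move=> _ [_ [s _ <-] <-]; exists s => //.
by rewrite to_semifracM -mulrA xy mulr1.
Qed.

Lemma noetherian_dedekind : noetherian S ->
  (forall a b, is_ideal a -> is_ideal b ->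
     invertible_ideal a -> invertible_ideal b -> invertible_ideal (a + b)) ->
  dedekind S.
Proof.
move=> noethS addI A fA An0; apply: has_inverse_invertible => //.
have [[x0 Ax0] AD AM [d d0 dA]] := fA.
pose a : set S := [set s | exists2 x, A x & s%:K = (d%:K * x)%R].
have ida : is_ideal a.
  split.
  - by have [s _ sx] := dA x0 Ax0; exists s; exists x0.
  - move=> s t [x Ax sx] [y Ay ty]; exists (x + y)%R; first exact: AD.
    by rewrite to_semifracD mulrDr sx ty.
  - move=> r s [x Ax sx]; exists (r%:K * x)%R; first exact: AM.
    by rewrite to_semifracM sx mulrCA.
have : a `<=` [set 0%R] \/ invertible_ideal a.
  have [G /finite_seqP[s ->] ->] := noethS a ida.
  elim: s => [|x s IHs]; first by left; apply: smallest_ideal_nil.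
  have idx := is_ideal_principal _ x; have ids := is_ideal_smallest _ [set` s].
  rewrite smallest_ideal_cons; have [->|x0'] := eqVneq x 0%R.
    suff -> : principal _ 0%R + smallest (@is_ideal _) [set` s] =
              smallest (@is_ideal _) [set` s] by [].
    apply/seteqP; split; last exact: sub_addr (is_ideal_principal _ _).
    by move=> _ [_ [r _ <-] [y sy <-]]; rewrite mulr0 add0r.
  right; have invx := invertible_principal x x0'.
  case: IHs => [s0|]; last exact: addI.
  suff -> : principal _ x + smallest (@is_ideal _) [set` s] = principal _ x by [].
  apply/seteqP; split; last exact: sub_addl.
  by move=> _ [y xy [z /s0 -> <-]]; rewrite addr0.
have [e de] : exists e, (d%:K * e)%R = 1%R.
  by apply: semifrac_inv; apply: contra_neq d0; apply: to_semifrac_eq0.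
case=> [a0|].
  exfalso; apply: An0; have A0 x : A x -> x = 0%R.
    move=> Ax; have [s _ sx] := dA x Ax; have s0 : s = 0%R by apply: a0; exists x.
    by rewrite -[x]mul1r -de mulrAC -sx s0 to_semifrac0 mul0r.
  by apply/seteqP; split=> [x /A0 //|_ ->]; rewrite -(A0 _ Ax0).
apply: mulset_sub; [exact: mulset0|exact: mulsetD|].
move=> _ p [s [x Ax sx] <-] Ip; rewrite sx mulrAC mulrC.
apply: mulsetP => // y Ay; have [t _ ty] := dA y Ay.
by rewrite mulrCA mulrA -ty; apply: Ip; exists t => //; exists y.
Qed.

Lemma add_mul_cap_dedekind : noetherian S ->
  (forall a b, is_ideal a -> is_ideal b -> (a + b) * (a `&` b) = a * b) ->
  dedekind S.
Proof.
move=> noethS addI; apply: noetherian_dedekind => // a b ida idb a1 b1.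
set ab := @to_semifrac S @` (a + b).
rewrite /invertible_ideal /has_inverse -/ab.
have C0 := mulset0 _ ab (inverse ab); have CD := mulsetD _ ab (inverse ab).
have step x p y q : a x -> inverse (@to_semifrac S @` a) p ->
    b y -> inverse (@to_semifrac S @` b) q ->
    (ab * inverse ab)%ideal (x%:K * p * (y%:K * q))%R.
  move=> ax Ip b_y Iq; rewrite mulrACA -to_semifracM.
  have : (a * b)%ideal (x * y)%R by apply: mulsetP.
  rewrite -addI // => xy.
  apply: (@mulset_sub _ _ _ [set z | (ab * inverse ab)%ideal (z%:K * (p * q))%R]) xy.
  - by rewrite /= mul0r.
  - by move=> u v /= ? ?; rewrite to_semifracD mulrDl; apply: CD.
  move=> u v abu [av bv] /=; rewrite to_semifracM -mulrA.
  apply: mulsetP; first by exists u.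
  move=> _ [_ [s a_s [t bt <-]] <-].
  have -> : ((s + t)%R%:K * (v%:K * (p * q)) =
    (s%:K * p) * (v%:K * q) + (v%:K * p) * (t%:K * q) :> K)%R.
    by rewrite to_semifracD; ring.
  apply: range_to_semifracD; apply: range_to_semifracM.
  - by apply: Ip; exists s.
  - by apply: Iq; exists v.
  - by apply: Ip; exists v.
  - by apply: Iq; exists t.
rewrite -[1%R]mulr1.
apply: (@mulset_sub _ _ _ [set z | (ab * inverse ab)%ideal (z * 1)%R]) a1.
- by rewrite /= mul0r.
- by move=> u v /= ? ?; rewrite mulrDl; apply: CD.
move=> _ p [x ax <-] Ip /=.
apply: (@mulset_sub _ _ _ [set z | (ab * inverse ab)%ideal (x%:K * p * z)%R]) b1.
- by rewrite /= mulr0.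
- by move=> u v /= ? ?; rewrite mulrDr; apply: CD.
by move=> _ q [y b_y <-] Iq; apply: step.
Qed.

Lemma comaximal_dedekind : noetherian S -> comaximal_residuals S -> dedekind S.
Proof.
move=> noethS com; apply: noetherian_dedekind => // a b ida idb a1 b1.
set ab := @to_semifrac S @` (a + b).
have C0 := mulset0 _ ab (inverse ab); have CD := mulsetD _ ab (inverse ab).
have [u [v [ub va uv]]] := comaximal_residuals_split _ com a b ida idb.
rewrite /invertible_ideal /has_inverse -/ab -to_semifrac1 -uv to_semifracD.
apply: (CD).
- rewrite -[u%:K]mulr1.
  apply: (@mulset_sub _ _ _ [set z | (ab * inverse ab)%ideal (u%:K * z)%R]) a1.
  + by rewrite /= mulr0.
  + by move=> ? ? /= ? ?; rewrite mulrDr; apply: CD.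
  move=> _ p [x ax <-] Ip /=; rewrite mulrCA; apply: mulsetP.
    by exists x => //; apply: sub_addl.
  move=> _ [_ [s a_s [t bt <-]] <-].
  rewrite mulrA -to_semifracM; apply: Ip; exists ((s + t) * u)%R => //.
  rewrite mulrC mulrDr; apply: idealD => //; [exact: idealMl|exact: ub].
- rewrite -[v%:K]mulr1.
  apply: (@mulset_sub _ _ _ [set z | (ab * inverse ab)%ideal (v%:K * z)%R]) b1.
  + by rewrite /= mulr0.
  + by move=> ? ? /= ? ?; rewrite mulrDr; apply: CD.
  move=> _ p [x ax <-] Ip /=; rewrite mulrCA; apply: mulsetP.
    by exists x => //; apply: sub_addr.
  move=> _ [_ [s a_s [t bt <-]] <-].
  rewrite mulrA -to_semifracM; apply: Ip; exists ((s + t) * v)%R => //.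
  rewrite mulrC mulrDr; apply: idealD => //; [exact: va|exact: idealMl].
Qed.

End Invertibility.

Theorem theorem3p5 (S : semidomainType) (noethS : noetherian S) :
  [<-> dedekind S;
       forall a b c : set S, is_ideal a -> is_ideal b -> is_ideal c ->
           a * (b `&` c) = (a * b) `&` (a * c);
       forall a b : set S, is_ideal a -> is_ideal b ->
           (a + b) * (a `&` b) = a * b;
       forall a b c : set S, is_ideal a -> is_ideal b -> is_ideal c ->
           [(a + b) : c] = [a : c] + [b : c];
       forall a b : set S, is_ideal a -> is_ideal b ->
           [a : b] + [b : a] = [set: S];
       forall a b c : set S, is_ideal a -> is_ideal b -> is_ideal c ->
           [c : a `&` b] = [c : a] + [c : b]].
Proof.
tfae.
- exact: dedekind_mul_cap.
- exact: add_mul_cap.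
- move=> addI; apply: comaximal_residual_add; apply: dedekind_comaximal.
  exact: add_mul_cap_dedekind.
- exact: residual_add_comaximal.
- exact: comaximal_residual_cap.
- by move=> resI; apply/(comaximal_dedekind _ noethS)/residual_cap_comaximal.
Qed.
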